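(* Let $X,Y$ be maximal Gromov product spaces (whose Gromov product boundaries have at least four points) and let $f:\partial_PX\to\partial_PY$ be a Moebius homeomorphism. Then $f$ extends to an isometry (distance-preserving bijection) $F:X\to Y$, i.e. there is an isometry $F:X\to Y$ such that $F\cup f:\widehat X^P\to\widehat Y^P$ is continuous.
   Context: A metric space is proper if closed balls are compact, and geodesically complete if every geodesic segment extends to a bi-infinite geodesic. $(y|z)_x=\frac12(d(x,y)+d(x,z)-d(y,z))$. A proper, geodesic, geodesically complete metric space $X$ is a Gromov product space if there is a second countable Hausdorff compactification $\widehat X$ of $X$ such that for every $x\in X$ the Gromov product $(\cdot|\cdot)_x:X\times X\to[0,+\infty)$ extends to a continuous function $\widehat X\times\widehat X\to[0,+\infty]$ such that for $\xi,\eta\in\widehat X\setminus X$, $(\xi|\eta)_x=+\infty$ if and only if $\xi=\eta$. Such a compactification is unique up to equivalence; it is denoted $\widehat X^P$, and $\partial_PX:=\widehat X^P\setminus X$ is the Gromov product boundary. For $x\in X$ set $\rho_x=e^{-(\cdot|\cdot)_x}$ on $\partial_PX\times\partial_PX$. The cross-ratio $[\xi,\xi',\eta,\eta']_{\rho_x}=\frac{\rho_x(\xi,\eta)\rho_x(\xi',\eta')}{\rho_x(\xi,\eta')\rho_x(\xi',\eta)}$ of quadruples of distinct points of $\partial_PX$ does not depend on $x$. A map between Gromov product boundaries is Moebius if it preserves these cross-ratios on all quadruples of distinct points. A Gromov product space $X$ is maximal if for every Gromov product space $Y$ and Moebius homeomorphism $f:\partial_PY\to\partial_PX$, there is an isometric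 (distance-preserving) embedding $F:Y\to X$ extending $f$, i.e. such that the map $F\cup f:\widehat Y^P\to\widehat X^P$ (equal to $F$ on $Y$ and to $f$ on $\partial_PY$) is continuous. *)

(* Defs.v *)
From HB Require Import structures.
From mathcomp Require Import all_boot all_order all_algebra.
From mathcomp Require Import all_classical all_reals all_analysis.

Set Implicit Arguments.
Unset Strict Implicit.
Unset Printing Implicit Defensive.

Import Order.TTheory GRing.Theory Num.Theory.
Import numFieldTopology.Exports numFieldNormedType.Exports.

Local Open Scope classical_set_scope.
Local Open Scope ring_scope.

Section MetricNotions.
Context {R : realType}.

(* The library's [closed_ball] is the closure of the open ball, hence the
   explicit set here. *)
Definition proper_space (X : metricType R) : Prop :=
  forall (x : X) (r : R), compact [set y : X | mdist x y <= r].

Definition isometric_embedding (X Y : metricType R) (F : X -> Y) : Prop :=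
  forall x y : X, mdist (F x) (F y) = mdist x y.

Definition is_isometry (X Y : metricType R) (F : X -> Y) : Prop :=
  isometric_embedding F /\ bijective F.

Definition geodesic_on (X : metricType R) (D : set R) (c : R -> X) : Prop :=
  forall s t : R, D s -> D t -> mdist (c s) (c t) = `|s - t|.

Definition geodesic_space (X : metricType R) : Prop :=
  forall x y : X, exists c : R -> X,
    [/\ c 0 = x, c (mdist x y) = y & geodesic_on `[0, mdist x y] c].

(* A geodesic segment is represented by a map on all of [R] of which only the
   restriction to [a, b] matters. *)
Definition geodesically_complete (X : metricType R) : Prop :=
  forall (a b : R) (c : R -> X), a <= b -> geodesic_on `[a, b] c ->
    exists2 g : R -> X, geodesic_on [set: R] g &
      forall t, t \in `[a, b] -> g t = c t.

Definition gromov_product (X : metricType R) (x y z : X) : R :=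
  2^-1 * (mdist x y + mdist x z - mdist y z).

End MetricNotions.

Definition homeomorphism (S T : topologicalType) (f : S -> T) : Prop :=
  exists g : T -> S, [/\ continuous f, continuous g, cancel f g & cancel g f].

Definition topological_embedding (S T : topologicalType) (i : S -> T) : Prop :=
  injective i /\
  forall A : set S, open A <-> exists2 B : set T, open B & i @^-1` B = A.

(* The values are taken in \bar R, so nonnegativity is required separately. *)
Definition is_gromov_extension (R : realType) (X : metricType R)
    (hX : topologicalType) (i : X -> hX) (x : X) (g : hX * hX -> \bar R) : Prop :=
  [/\ continuous g,
      forall p, (0 <= g p)%E,
      forall y z : X, g (i y, i z) = (gromov_product x y z)%:E &
      forall xi eta : hX, (~` range i) xi -> (~` range i) eta ->
        (g (xi, eta) = +oo%E <-> xi = eta)].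

Record gromov_compactification (R : realType) (X : metricType R) :=
  GromovCompactification {
  gc_space :> topologicalType ;
  gc_incl : X -> gc_space ;
  gc_compact : compact [set: gc_space] ;
  gc_hausdorff : hausdorff_space gc_space ;
  gc_second_countable : @second_countable gc_space ;
  gc_embedding : topological_embedding gc_incl ;
  gc_dense : dense (range gc_incl) ;
  gc_extension : forall x : X, exists g, is_gromov_extension gc_incl x g
}.

(* The compactification is unique up to equivalence; a representative is
   carried as data. *)
Record gromovProductSpace (R : realType) := GromovProductSpace {
  gps_space :> metricType R ;
  gps_proper : proper_space gps_space ;
  gps_geodesic : geodesic_space gps_space ;
  gps_complete : geodesically_complete gps_space ;
  gps_hat : gromov_compactification gps_space
}.

Section GromovProductSpaces.
Context {R : realType}.
Implicit Types X Y : gromovProductSpace R.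

Definition incl X : X -> gps_hat X := @gc_incl R X (gps_hat X).

Definition boundary X : set (gps_hat X) := ~` range (@incl X).
Arguments boundary : clear implicits.

(* The extension is unique because X is dense in its compactification. *)
Definition gromov_ext X (x : X) : gps_hat X * gps_hat X -> \bar R :=
  projT1 (cid (gc_extension (gps_hat X) x)).

Lemma gromov_extP X (x : X) : is_gromov_extension (@incl X) x (gromov_ext x).
Proof. exact: (projT2 (cid (gc_extension (gps_hat X) x))). Qed.

(* [expeR] sends -oo to 0, so the value is 0 on the diagonal. *)
Definition rho X (x : X) (xi eta : boundary X) : R :=
  fine (expeR (- gromov_ext x (set_val xi, set_val eta))%E).

Definition cross_ratio X (x : X) (xi xi' eta eta' : boundary X) : R :=
  (rho x xi eta * rho x xi' eta') / (rho x xi eta' * rho x xi' eta).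

(* Cross-ratios do not depend on the base point, hence neither does this. *)
Definition moebius X Y (f : boundary X -> boundary Y) : Prop :=
  forall (x : X) (y : Y) (xi xi' eta eta' : boundary X),
    uniq [:: xi; xi'; eta; eta'] ->
    cross_ratio y (f xi) (f xi') (f eta) (f eta') =
    cross_ratio x xi xi' eta eta'.

Definition union_map X Y (F : X -> Y) (f : boundary X -> boundary Y)
    (p : gps_hat X) : gps_hat Y :=
  match pselect (range (@incl X) p) with
  | left pX => incl (F (sval (cid2 pX)))
  | right pB => set_val (f (exist _ p (mem_set pB)))
  end.

Lemma union_map_incl X Y (F : X -> Y) (f : boundary X -> boundary Y) (x : X) :
  union_map F f (incl x) = incl (F x).
Proof.
rewrite /union_map; case: pselect => [pX|]; last by case; exists x.
case: cid2 => y _ /= yx; congr (incl (F _)).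
by have [inj _] := gc_embedding (gps_hat X); apply: inj.
Qed.

Lemma union_map_boundary X Y (F : X -> Y) (f : boundary X -> boundary Y)
  (xi : boundary X) : union_map F f (set_val xi) = set_val (f xi).
Proof.
rewrite /union_map; case: pselect => [pX|pB].
  by have /set_mem := valP xi; case.
by congr (set_val (f _)); apply: val_inj.
Qed.

Definition maximal X : Prop :=
  forall (Y : gromovProductSpace R) (f : boundary Y -> boundary X),
    homeomorphism f -> moebius f ->
    exists2 F : Y -> X, isometric_embedding F & continuous (union_map F f).

End GromovProductSpaces.
Arguments boundary {R} X _.

(* Main.v *)
Require Import Defs.
From mathcomp Require Import all_boot all_order all_algebra.
From mathcomp Require Import all_classical all_reals all_analysis.
From mathcomp Require Import lra.

(** The two maximality hypotheses give isometric embeddings [F : X -> Y]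
extending [f] and [G : Y -> X] extending the inverse of [f], which is Moebius
as well.  Both [G \o F] and [F \o G] are isometric embeddings that extend
continuously by the identity of the boundary, so everything reduces to a
rigidity statement ([rigidity]): an isometric embedding [H : X -> X] that
extends the identity of the boundary is the identity, as soon as the boundary
has three points.

To see this, fix [x], put [d = mdist x (H x)] and write
[a xi = (H x | xi)_x] for [xi] in the boundary; the number [2 a xi - d] is the
value at [xi] of the Busemann cocycle of the pair [x, H x].
- Since [H] preserves distances, [(H y | H z)_(H x) = (y | z)_x]; by continuity
  and density this passes to the boundary, where [H] is the identity, so that
  [x] and [H x] induce the same Gromov products there.
- The change of base point formula ([gromov_ext_base]) then becomes
  [a xi + a eta = d] for all distinct [xi], [eta], and comparing three boundary
  points yields [a xi = d / 2] for every [xi].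
- Extend a geodesic from [x] to [H x] to a geodesic ray.  It accumulates at some
  boundary point [xi] ([ray_endpoint]), and [a xi = d] because [(H x | z)_x = d]
  for every point [z] of the ray beyond [H x].
Hence [d = d / 2], that is [H x = x]. *)

Set Implicit Arguments.
Unset Strict Implicit.
Unset Printing Implicit Defensive.

Import Order.TTheory GRing.Theory Num.Theory.
Import numFieldTopology.Exports numFieldNormedType.Exports.

Local Open Scope classical_set_scope.
Local Open Scope ring_scope.
Local Open Scope card_scope.

Local Notation incl := (@Defs.incl _ _).

(** * Density and continuous functions *)

Lemma eq_on_dense (T V : topologicalType) (D : set T) (f g : T -> V) :
  hausdorff_space V -> continuous f -> continuous g -> dense D ->
  {in D, f =1 g} -> f =1 g.
Proof.
move=> hV fc gc dD fg p; apply: hV => A B fpA gpB.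
have pU : nbhs p (f @^-1` A `&` g @^-1` B).
  by apply: filterI; [exact: fc|exact: gc].
have [q [qU qD]] : ((f @^-1` A `&` g @^-1` B)° `&` D) !=set0.
  by apply: dD; [exists p|exact: open_interior].
have [qA qB] := interior_subset qU.
by exists (f q); split => //; rewrite (fg q (mem_set qD)).
Qed.

Lemma dense_setX (T U : topologicalType) (D : set T) (E : set U) :
  dense D -> dense E -> dense (D `*` E).
Proof.
move=> dD dE O [[p q] Opq] oO.
have [[A B]/= [pA qB] ABO] : nbhs (p, q) O by apply: open_nbhs_nbhs.
have [s [sA sD]] : (A° `&` D) !=set0.
  by apply: dD; [exists p|exact: open_interior].
have [t [tB tE]] : (B° `&` E) !=set0.
  by apply: dE; [exists q|exact: open_interior].
exists (s, t); split=> //; apply: ABO; split => /=; exact: interior_subset.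
Qed.

(** * Extended Gromov products *)

Section GromovExtension.
Context {R : realType} {X : gromovProductSpace R}.
Local Notation hX := (gps_hat X).
Local Notation e := gromov_ext.
Implicit Types (x y z : X) (p q : hX) (xi eta : boundary X).

Lemma gromov_ext_continuous x : continuous (e x).
Proof. by have [] := gromov_extP x. Qed.

Lemma gromov_ext_ge0 x u : (0 <= e x u)%E.
Proof. by have [] := gromov_extP x. Qed.

Lemma gromov_ext_incl x y z : e x (incl y, incl z) = (gromov_product x y z)%:E.
Proof. by have [] := gromov_extP x. Qed.

Lemma gromov_ext_boundary x xi eta :
  xi != eta -> e x (set_val xi, set_val eta) != +oo%E.
Proof.
move=> ne; have [_ _ _ h] := gromov_extP x; apply/eqP.
move=> /(h _ _ (set_mem (valP xi)) (set_mem (valP eta))) /val_inj E.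
by rewrite E eqxx in ne.
Qed.

Lemma eq_gromov_compactification2 (g h : hX * hX -> \bar R) :
  continuous g -> continuous h ->
  (forall y z, g (incl y, incl z) = h (incl y, incl z)) -> g =1 h.
Proof.
move=> gc hc gh; have dX := @gc_dense _ _ hX.
apply: (eq_on_dense (@ereal_hausdorff R) gc hc (dense_setX dX dX)).
by move=> [p q] /set_mem[[y _ /= <-] [z _ /= <-]]; exact: gh.
Qed.

Lemma continuous_gromov_ext_pair (T : topologicalType) x (u v : T -> hX) :
  continuous u -> continuous v -> continuous (fun t => e x (u t, v t)).
Proof.
move=> uc vc t.
apply: (@continuous_comp _ _ _ (fun t => (u t, v t)) (e x)).
  by apply: cvg_pair; [exact: uc|exact: vc].
exact: gromov_ext_continuous.
Qed.

(** The formula is arithmetic on [X], where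
[2 ((z|w)_x - (z|w)_y) = d(x,z) - d(y,z) + d(x,w) - d(y,w)], and it extends by
density.  It is written with sums of nonnegative terms only, so that infinite
values cause no indeterminate form. *)
Lemma gromov_ext_base x y p q :
  (e x (p, q) + (mdist x y)%:E =
   e y (p, q) + (e x (incl y, p) + e x (incl y, q)))%E.
Proof.
pose lhs u := (e x u + (mdist x y)%:E)%E.
pose rhs (u : hX * hX) := (e y u + (e x (incl y, u.1) + e x (incl y, u.2)))%E.
have ge0 := gromov_ext_ge0.
have lc : continuous lhs.
  move=> u; apply: cvgeD; last exact: cvg_cst.
    by rewrite ge0_adde_def ?inE ?ge0 ?lee_fin ?mdist_ge0.
  exact: gromov_ext_continuous.
have rc : continuous rhs.
  move=> u; apply: cvgeD; [|exact: gromov_ext_continuous|apply: cvgeD].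
  - by rewrite ge0_adde_def ?inE ?adde_ge0 ?ge0.
  - by rewrite ge0_adde_def ?inE ?ge0.
  - by apply: (@continuous_gromov_ext_pair _ x (fun=> incl y) fst) => t;
      [exact: cvg_cst|exact: cvg_fst].
  - by apply: (@continuous_gromov_ext_pair _ x (fun=> incl y) snd) => t;
      [exact: cvg_cst|exact: cvg_snd].
apply: (eq_gromov_compactification2 lc rc _ (p, q)) => z w.
rewrite /lhs /rhs /= !gromov_ext_incl -!EFinD /gromov_product; congr EFin.
by lra.
Qed.

(** A cluster point of the ray in the compact space [hX] cannot lie in [X],
since bounded parts of the ray have bounded parameters.  The equation on Gromov
products is a closed condition satisfied along the ray from [t = d] on. *)
Lemma ray_endpoint x y (c : R -> X) :
  geodesic_on [set: R] c -> c 0 = x -> c (mdist x y) = y ->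
  exists xi, e x (incl y, set_val xi) = (mdist x y)%:E.
Proof.
set d := mdist x y => cg c0 cd.
have d0 : 0 <= d by exact: mdist_ge0.
have cE s t : mdist (c s) (c t) = `|s - t| by exact: cg.
have [p [_ pc]] : [set: hX] `&` cluster ((@Defs.incl R X \o c) @ +oo) !=set0.
  by apply: (@gc_compact _ _ hX); exact: filterT.
have near_ray M (B : set hX) : nbhs p B -> exists2 t, M < t & B (incl (c t)).
  move=> pB; have [|_ [[t Mt <-] Bt]] := pc ((@Defs.incl R X \o c) @` [set t | M < t]) B _ pB.
    exists M; split; first exact: num_real.
    by move=> t Mt; exists t.
  by exists t.
have pb : boundary X p.
  move=> [z _ zp]; have [_ emb] := gc_embedding hX.
  have [/(_ (open_nbhs_ball z 1%:pos).1) [B oB BE] _] := emb (ball z 1)°.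
  have pB : nbhs p B.
    rewrite -zp; apply: open_nbhs_nbhs; split => //.
    suff : (@Defs.incl R X @^-1` B) z by [].
    by rewrite BE; exact: nbhsx_ballx.
  have [t Mt Bt] := near_ray (mdist x z + 1) B pB.
  have : ball z 1 (c t) by apply: interior_subset; rewrite -BE.
  rewrite ballEmdist /= => zt.
  have := metric_triangle x z (c t); rewrite -{1}c0 cE sub0r normrN.
  by have := ler_norm t; lra.
exists (SigSub (mem_set pb)) => /=.
apply: (@ereal_hausdorff R) => A B pA dB.
have pA' : nbhs p ((fun q => e x (incl y, q)) @^-1` A).
  apply: (@continuous_gromov_ext_pair _ x (fun=> incl y) id _ _ p A pA) => q.
    exact: cvg_cst.
  exact: cvg_id.
have [t dt At] := near_ray d _ pA'.
suff Et : e x (incl y, incl (c t)) = d%:E.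
  by exists d%:E; split; [rewrite -Et|exact: nbhs_singleton].
rewrite gromov_ext_incl /gromov_product -/d -{1}c0 -cd !cE sub0r normrN.
rewrite ger0_norm ?ler0_norm; [|lra..].
by congr EFin; lra.
Qed.

End GromovExtension.

(** * Rigidity of isometric embeddings fixing the boundary *)

Lemma exists_two_others (T : choiceType) (A : set T) (x : A) :
  [set: 'I_3] #<= A -> exists y z : A, [&& x != y, x != z & y != z].
Proof.
move=> /card_leP[g].
pose k (i : 'I_3) := g (to_setT i).
have kI : injective k.
  by move=> i j /(@inj _ _ _ g) ij; apply: (congr1 val (ij _ _)); rewrite inE.
have k01 : k (inord 0) != k (inord 1) by rewrite (inj_eq kI) -val_eqE /= !inordK.
have k02 : k (inord 0) != k (inord 2) by rewrite (inj_eq kI) -val_eqE /= !inordK.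
have k12 : k (inord 1) != k (inord 2) by rewrite (inj_eq kI) -val_eqE /= !inordK.
have [->|x0] := eqVneq x (k (inord 0)).
  by exists (k (inord 1)), (k (inord 2)); rewrite k01 k02 k12.
have [->|x1] := eqVneq x (k (inord 1)).
  by exists (k (inord 0)), (k (inord 2)); rewrite eq_sym k01 k12 k02.
by exists (k (inord 0)), (k (inord 1)); rewrite x0 x1 k01.
Qed.

(** Seen from the boundary, [x] and [H x] have the same Gromov products, which
forces [(H x | xi)_x = d(x, H x) / 2] for every boundary point [xi]; at the
endpoint of a ray from [x] through [H x] that product is [d(x, H x)]. *)
Lemma rigidity (R : realType) (X : gromovProductSpace R) (H : X -> X)
    (h : gps_hat X -> gps_hat X) :
  [set: 'I_3] #<= boundary X -> isometric_embedding H -> continuous h ->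
  (forall x, h (incl x) = incl (H x)) ->
  (forall xi : boundary X, h (set_val xi) = set_val xi) -> H =1 id.
Proof.
move=> X3 Hiso hc hX hb x; apply/esym.
set y := H x; set d := mdist x y.
(* Both sides are continuous in [(p, q)]; on [X] they agree because [H]
   preserves distances. *)
have same p q : gromov_ext y (h p, h q) = gromov_ext x (p, q).
  apply: (eq_gromov_compactification2 (g := fun u => gromov_ext y (h u.1, h u.2))
    _ _ _ (p, q)) => [||z w].
  - apply: continuous_gromov_ext_pair => u; apply: continuous_comp;
      by [exact: cvg_fst|exact: cvg_snd|exact: hc].
  - exact: gromov_ext_continuous.
  - by rewrite /= !hX !gromov_ext_incl /gromov_product !Hiso.
pose a (xi : boundary X) := gromov_ext x (incl y, set_val xi).
(* The products of [xi] and [eta] based at [x] and at [y] are equal, and finite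
   as [xi != eta], so they cancel in the change of base point formula. *)
have aD xi eta : xi != eta -> (a xi + a eta = d%:E)%E.
  move=> ne; have := gromov_ext_base x y (set_val xi) (set_val eta).
  rewrite -(same (set_val xi)) !hb -/d -/(a _) -/(a _).
  have := gromov_ext_boundary y ne.
  have := gromov_ext_ge0 y (set_val xi, set_val eta).
  case: (gromov_ext y _) => [r| |] // _ _ E.
  by move: E; case: (a xi) (a eta) => [s| |] [t| |] //; rewrite -!EFinD => -[/addrI ->].
(* As [a xi] is one of two nonnegative summands of the real number [d], it is
   finite. *)
have aR xi : exists r, a xi = r%:E.
  have [eta [_ /andP[ne _]]] := exists_two_others xi X3.
  have := aD _ _ ne; have := gromov_ext_ge0 x (incl y, set_val eta).
  have := gromov_ext_ge0 x (incl y, set_val xi); rewrite -/(a _) -/(a _).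
  by case: (a xi) (a eta) => [r| |] // [s| |] //; exists r.
have [c [c0 cd cg]] := gps_geodesic x y.
have [g gg gE] := gps_complete (mdist_ge0 x y) cg.
have [||xi axi] := ray_endpoint (x := x) (y := y) gg.
- by rewrite gE // in_itv /= lexx mdist_ge0.
- by rewrite gE // in_itv /= lexx mdist_ge0.
have [eta [zeta /and3P[n1 n2 n3]]] := exists_two_others xi X3.
have [r ar] := aR eta; have [s as_] := aR zeta.
have := aD _ _ n1; have := aD _ _ n2; have := aD _ _ n3.
rewrite ar as_ /a axi -!EFinD => -[E1] [E2] [E3].
by apply: mdist_positivity; rewrite -/d in E2 E3 *; lra.
Qed.

(** * Extensions of a Moebius homeomorphism and of its inverse *)

Lemma moebius_inverse (R : realType) (X Y : gromovProductSpace R)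
    (f : boundary X -> boundary Y) (g : boundary Y -> boundary X) :
  cancel g f -> moebius f -> moebius g.
Proof.
move=> gK fM y x xi xi' eta eta' U.
rewrite -(fM x y) ?gK //.
by have := map_inj_uniq (can_inj gK) [:: xi; xi'; eta; eta'] => /= ->.
Qed.

(** [G \o F] extends continuously by the identity of the boundary, through
[union_map G g \o union_map F f]. *)
Lemma extensions_cancel (R : realType) (X Y : gromovProductSpace R)
    (f : boundary X -> boundary Y) (g : boundary Y -> boundary X)
    (F : X -> Y) (G : Y -> X) :
  [set: 'I_3] #<= boundary X -> cancel f g ->
  isometric_embedding F -> isometric_embedding G ->
  continuous (union_map F f) -> continuous (union_map G g) -> cancel F G.
Proof.
move=> X3 fK Fiso Giso Fc Gc.
apply: (rigidity (H := G \o F) (h := union_map G g \o union_map F f)) => //.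
- by move=> x y; rewrite /= Giso Fiso.
- by move=> p; apply: continuous_comp; [exact: Fc|exact: Gc].
- by move=> x; rewrite /= !union_map_incl.
- by move=> xi; rewrite /= !union_map_boundary fK.
Qed.

Theorem theorem1p8 (R : realType) (X Y : gromovProductSpace R)
  (X_maximal : maximal X) (Y_maximal : maximal Y)
  (X_four : [set: 'I_4] #<= boundary X) (Y_four : [set: 'I_4] #<= boundary Y)
  (f : boundary X -> boundary Y)
  (f_homeo : homeomorphism f) (f_moebius : moebius f) :
  exists2 F : X -> Y, is_isometry F & continuous (union_map F f).
Proof.
have three (S : gromovProductSpace R) :
    [set: 'I_4] #<= boundary S -> [set: 'I_3] #<= boundary S.
  apply: card_le_trans.
  have [k] : $|{injfun [set: 'I_3] >-> [set: 'I_4]}|.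
    apply/injfunPex; exists (@widen_ord 3 4 isT) => // i j _ _.
    by move=> /(congr1 val) /= /val_inj.
  exact: inj_card_le k.
have [g [fc gc fK gK]] := f_homeo.
have [F Fiso Fc] := Y_maximal X f f_homeo f_moebius.
have [||G Giso Gc] := X_maximal Y g.
- by exists f; split.
- exact: moebius_inverse gK f_moebius.
exists F => //; split => //; exists G.
- exact: extensions_cancel (three _ X_four) fK Fiso Giso Fc Gc.
- exact: extensions_cancel (three _ Y_four) gK Giso Fiso Gc Fc.
Qed.
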